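(* (Tensor Krylov factorizations.) Let a tensor $\mathcal{A}\in\mathbb{R}^{l\times m\times n}$ and two starting vectors $u_1$ and $v_1$ be given. Assume that matrices with orthonormal columns, and a tensor $\mathcal{H}$ of orthonormalization coefficients, have been generated using the maximal Krylov recursion. Assume that after a complete $u$-loop the matrices $U_\alpha$, $V_\beta$ and $W_\gamma$, and the tensor $\mathcal{H}_{\alpha\beta\gamma}\in\mathbb{R}^{\alpha\times\beta\times\gamma}$, have been generated, where $\alpha\le l$, $\beta\le m$ and $\gamma\le n$. Then $$\mathcal{A}\cdot(V_\beta,W_\gamma)_{2,3}=(U_\alpha)_1\cdot\mathcal{H}_{\alpha\beta\gamma}.$$ Further, assume that after the following complete $v$-loop we have orthonormal matrices $U_\alpha$, $V_{\bar\beta}$, $W_\gamma$ and the tensor $\mathcal{H}_{\alpha\bar\beta\gamma}\in\mathbb{R}^{\alpha\times\bar\beta\times\gamma}$, where $\bar\beta=\alpha\gamma+1>\beta$. Then $$\mathcal{A}\cdot(U_\alpha,W_\gamma)_{1,3}=(V_{\bar\beta})_2\cdot\mathcal{H}_{\alpha\bar\beta\gamma}.$$ Similarly, after the following complete $w$-loop, we have orthonormal matrices $U_\alpha$, $V_{\bar\beta}$, $W_{\bar\gamma}$ and the tensor $\mathcal{H}_{\alpha\bar\beta\bar\gamma}\in\mathbb{R}^{\alpha\times\bar\beta\times\bar\gamma}$, where $\bar\gamma=\alpha\bar\beta>\gamma$. Then $$\mathcal{A}\cdot(U_\alpha,V_{\bar\beta})_{1,2}=(W_{\bar\gamma})_3\cdot\mathcal{H}_{\alpha\bar\beta\bar\gamma}.$$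 It also holds that $\mathcal{H}_{\alpha\beta\gamma}=\mathcal{H}_{\alpha\bar\beta\gamma}(1:\alpha,1:\beta,1:\gamma)$ and $\mathcal{H}_{\alpha\bar\beta\gamma}=\mathcal{H}_{\alpha\bar\beta\bar\gamma}(1:\alpha,1:\bar\beta,1:\gamma)$, i.e. all orthonormalization coefficients from the $u$-, $v$- and $w$-loops are stored in a single and common tensor $\mathcal{H}$.
   Context: All tensors are real arrays of order three; $1:\alpha$ denotes the index range $1,\dots,\alpha$. Tensor-matrix multiplication: $(\mathcal{A}\cdot(V,W)_{2,3})_{ijk}=\sum_{\mu,\nu}a_{i\mu\nu}v_{\mu j}w_{\nu k}$, $(\mathcal{A}\cdot(U,W)_{1,3})_{ijk}=\sum_{\lambda,\nu}a_{\lambda j\nu}u_{\lambda i}w_{\nu k}$, $(\mathcal{A}\cdot(U,V)_{1,2})_{ijk}=\sum_{\lambda,\mu}a_{\lambda\mu k}u_{\lambda i}v_{\mu j}$, and $\mathcal{A}\cdot(U,V,W)$ multiplies in all three modes in the same way. With vectors in place of matrices, singleton modes are dropped, so e.g. $\mathcal{A}\cdot(v,w)_{2,3}\in\mathbb{R}^l$, $\mathcal{A}\cdot(u,w)_{1,3}\in\mathbb{R}^m$, $\mathcal{A}\cdot(u,v)_{1,2}\in\mathbb{R}^n$. For a tensor $\mathcal{H}$: $((U)_1\cdot\mathcal{H})_{ijk}=\sum_\lambda u_{i\lambda}h_{\lambda jk}$, $((V)_2\cdot\mathcal{H})_{ijk}=\sum_\mu v_{j\mu}h_{i\mu k}$,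 $((W)_3\cdot\mathcal{H})_{ijk}=\sum_\nu w_{k\nu}h_{ij\nu}$. ''Orthonormal matrix'' means a matrix with orthonormal columns. Notation: $U_\alpha=[u_1\,\cdots\,u_\alpha]$, $V_\beta=[v_1\,\cdots\,v_\beta]$, $W_\gamma=[w_1\,\cdots\,w_\gamma]$ are the matrices of all vectors generated so far in each mode. $\mathcal{H}_{\alpha\beta\gamma}$ denotes the current coefficient tensor $\mathcal{H}$ when its dimensions are $\alpha\times\beta\times\gamma$; its entries are written $h_{ijk}$. Maximal Krylov recursion. Given vectors $u_1\in\mathbb{R}^l$, $v_1\in\mathbb{R}^m$ of length one, set $h_{111}w_1=\mathcal{A}\cdot(u_1,v_1)_{1,2}$ with $h_{111}$ normalizing $w_1$ to length one; set $\alpha=\beta=\gamma=1$ and $\mathcal{H}=\mathcal{H}_{111}=h_{111}$; the pair $(u_1,v_1)$ now counts as used. Then repeat the following three loops in order. $u$-loop: start with an empty list $U=[\;]$ of new vectors and $i=1$. For every pair $(\bar\beta,\bar\gamma)$ with $\bar\beta\le\beta$, $\bar\gamma\le\gamma$ that has not been used before (for generating a $u$-vector): let $h_\alpha=\mathcal{H}(1:\alpha,\bar\beta,\bar\gamma)$ (coefficients already stored in $\mathcal{H}$) and $h_i=\mathcal{A}\cdot(U,v_{\bar\beta},w_{\bar\gamma})$ (the vector of inner products of $\mathcal{A}\cdot(v_{\bar\beta},w_{\bar\gamma})_{2,3}$ with the vectors in $U$), compute $$h_{\alpha+i,\bar\beta,\bar\gamma}\,u_{\alpha+i}=\mathcal{A}\cdot(v_{\bar\beta},w_{\bar\gamma})_{2,3}-U_\alpha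 h_\alpha-Uh_i,$$ where the scalar $h_{\alpha+i,\bar\beta,\bar\gamma}$ normalizes $u_{\alpha+i}$ to length one; set $\mathcal{H}(\alpha+1:\alpha+i,\bar\beta,\bar\gamma)=[h_i^{\mathsf T}\;\;h_{\alpha+i,\bar\beta,\bar\gamma}]^{\mathsf T}$, and fill the other mode-1 fibres of $\mathcal{H}$ with a zero in the new position $\alpha+i$ (entries set later in the loop overwrite these zeros); append $u_{\alpha+i}$ to $U$ and increase $i$ by one. When all pairs are exhausted, the loop is complete: put $U_{\beta\gamma+1}=[U_\alpha\;U]$ and reset $\alpha:=\beta\gamma+1$. $v$-loop: analogous in mode 2. For every pair $(\bar\alpha,\bar\gamma)$, $\bar\alpha\le\alpha$, $\bar\gamma\le\gamma$, not used before for generating a $v$-vector, with $V$ the list of new $v$-vectors of this loop: $h_\beta=\mathcal{H}(\bar\alpha,1:\beta,\bar\gamma)$, $h_j=\mathcal{A}\cdot(u_{\bar\alpha},V,w_{\bar\gamma})$, $h_{\bar\alpha,\beta+j,\bar\gamma}v_{\beta+j}=\mathcal{A}\cdot(u_{\bar\alpha},w_{\bar\gamma})_{1,3}-V_\beta h_\beta-Vh_j$, $\mathcal{H}(\bar\alpha,\beta+1:\beta+j,\bar\gamma)=[h_j^{\mathsf T}\;\;h_{\bar\alpha,\beta+j,\bar\gamma}]^{\mathsf T}$, other mode-2 fibres padded by zeros. On completion $V_{\alpha\gamma+1}=[V_\beta\;V]$ and $\beta:=\alpha\gamma+1$. $w$-loop: analogous in mode 3. For every pair $(\bar\alpha,\bar\beta)$,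 $\bar\alpha\le\alpha$, $\bar\beta\le\beta$, not used before for generating a $w$-vector, with $W$ the list of new $w$-vectors of this loop: $h_\gamma=\mathcal{H}(\bar\alpha,\bar\beta,1:\gamma)$, $h_k=\mathcal{A}\cdot(u_{\bar\alpha},v_{\bar\beta},W)$, $h_{\bar\alpha,\bar\beta,\gamma+k}w_{\gamma+k}=\mathcal{A}\cdot(u_{\bar\alpha},v_{\bar\beta})_{1,2}-W_\gamma h_\gamma-Wh_k$, $\mathcal{H}(\bar\alpha,\bar\beta,\gamma+1:\gamma+k)=[h_k^{\mathsf T}\;\;h_{\bar\alpha,\bar\beta,\gamma+k}]^{\mathsf T}$, other mode-3 fibres padded by zeros. On completion $W_{\alpha\beta}=[W_\gamma\;W]$ and $\gamma:=\alpha\beta$. All normalizations in the loops considered are assumed possible (the matrices generated have orthonormal columns). *)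

(* Defs.v *)
From HB Require Import structures.
From mathcomp Require Import all_boot all_order all_algebra.
From mathcomp Require Import reals.

Set Implicit Arguments.
Unset Strict Implicit.
Unset Printing Implicit Defensive.

Import Order.TTheory GRing.Theory Num.Theory.
Local Open Scope ring_scope.

(* All indices are 0-based: the vector u_i of the usual
   1-based notation is us`_(i-1), and likewise for the entries of tensors. *)

Notation tensor R a b c := {ffun 'I_a * 'I_b * 'I_c -> R}.

Section Tensors.
Variable R : realType.

Definition tmul23 l m n p q (A : tensor R l m n)
    (V : 'M[R]_(m, p)) (W : 'M[R]_(n, q)) : tensor R l p q :=
  [ffun x => \sum_mu \sum_nu A (x.1.1, mu, nu) * V mu x.1.2 * W nu x.2].

Definition tmul13 l m n p q (A : tensor R l m n)
    (U : 'M[R]_(l, p)) (W : 'M[R]_(n, q)) : tensor R p m q :=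
  [ffun x => \sum_la \sum_nu A (la, x.1.2, nu) * U la x.1.1 * W nu x.2].

Definition tmul12 l m n p q (A : tensor R l m n)
    (U : 'M[R]_(l, p)) (V : 'M[R]_(m, q)) : tensor R p q n :=
  [ffun x => \sum_la \sum_mu A (la, mu, x.2) * U la x.1.1 * V mu x.1.2].

Definition tmul l m n p q r (A : tensor R l m n) (U : 'M[R]_(l, p))
    (V : 'M[R]_(m, q)) (W : 'M[R]_(n, r)) : tensor R p q r :=
  [ffun x => \sum_la \sum_mu \sum_nu
     A (la, mu, nu) * U la x.1.1 * V mu x.1.2 * W nu x.2].

(* Products with vectors: vectors are one-column matrices, and the resulting
   singleton modes are dropped. *)
Definition tvec23 l m n (A : tensor R l m n) (v : 'cV[R]_m) (w : 'cV[R]_n) :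
    'cV[R]_l := \col_i tmul23 A v w (i, 0, 0).

Definition tvec13 l m n (A : tensor R l m n) (u : 'cV[R]_l) (w : 'cV[R]_n) :
    'cV[R]_m := \col_j tmul13 A u w (0, j, 0).

Definition tvec12 l m n (A : tensor R l m n) (u : 'cV[R]_l) (v : 'cV[R]_m) :
    'cV[R]_n := \col_k tmul12 A u v (0, 0, k).

Definition tvec l m n (A : tensor R l m n)
    (u : 'cV[R]_l) (v : 'cV[R]_m) (w : 'cV[R]_n) : R := tmul A u v w (0, 0, 0).

Definition mode1 p a b c (U : 'M[R]_(p, a)) (H : tensor R a b c) :
    tensor R p b c := [ffun x => \sum_la U x.1.1 la * H (la, x.1.2, x.2)].

Definition mode2 p a b c (V : 'M[R]_(p, b)) (H : tensor R a b c) :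
    tensor R a p c := [ffun x => \sum_mu V x.1.2 mu * H (x.1.1, mu, x.2)].

Definition mode3 p a b c (W : 'M[R]_(p, c)) (H : tensor R a b c) :
    tensor R a b p := [ffun x => \sum_nu W x.2 nu * H (x.1.1, x.1.2, nu)].

(* H = H'(1:a, 1:b, 1:c) *)
Definition leading_block a b c a' b' c'
    (H : tensor R a b c) (H' : tensor R a' b' c') : Prop :=
  [/\ (a <= a')%N, (b <= b')%N, (c <= c')%N &
      forall (i : 'I_a) (j : 'I_b) (k : 'I_c)
             (i' : 'I_a') (j' : 'I_b') (k' : 'I_c'),
        i' = i :> nat -> j' = j :> nat -> k' = k :> nat ->
        H (i, j, k) = H' (i', j', k')].

Definition length2 p (x : 'cV[R]_p) : R := Num.sqrt (\sum_i x i 0 ^+ 2).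

Definition orthonormal_cols p q (Q : 'M[R]_(p, q)) : Prop :=
  Q^T *m Q = 1%:M.

(* The equation h x = r in which the scalar h normalizes x to length one. The
   sign of h is left free; h != 0 says that the normalization is possible
   (r is not zero). *)
Definition normalizes p (h : R) (x r : 'cV[R]_p) : Prop :=
  [/\ h != 0, length2 x = 1 & h *: x = r].

Definition colsmx p (X : seq 'cV[R]_p) : 'M[R]_(p, size X) :=
  \matrix_(i, j) X`_j i 0.

End Tensors.

Section Krylov.
Variables (R : realType) (l m n : nat).

(* The coefficients are stored in a total function on nat^3, of which only the
   entries below the current dimensions are meaningful. [usedu] lists the pairs
   (v-index, w-index) already used to generate a u-vector, [usedv] the pairs
   (u-index, w-index) and [usedw] the pairs (u-index, v-index). *)
Record kstate := KState {
  us : seq 'cV[R]_l;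
  vs : seq 'cV[R]_m;
  ws : seq 'cV[R]_n;
  coef : nat -> nat -> nat -> R;
  usedu : seq (nat * nat);
  usedv : seq (nat * nat);
  usedw : seq (nat * nat) }.

Definition Hten (s : kstate) :
    tensor R (size (us s)) (size (vs s)) (size (ws s)) :=
  [ffun x : 'I_(size (us s)) * 'I_(size (vs s)) * 'I_(size (ws s)) =>
     coef s x.1.1 x.1.2 x.2].

Definition orthonormal_state (s : kstate) : Prop :=
  [/\ orthonormal_cols (colsmx (us s)), orthonormal_cols (colsmx (vs s))
    & orthonormal_cols (colsmx (ws s))].

(* New value at position [i] of a fibre with old value [x], when the dimension
   of the mode was [a] at the start of the loop and the vector in position
   a + size hs has just been generated: the fibre of the current pair
   ([cur] = true) receives the coefficients [hs] against the new vectors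
   followed by the normalization [h], any other fibre is padded by zero. *)
Definition fill (cur : bool) (a : nat) (hs : seq R) (h : R) (i : nat) (x : R) :
    R :=
  if cur then
    if (a <= i <= a + size hs)%N then (rcons hs h)`_(i - a) else x
  else if i == (a + size hs)%N then 0 else x.

Variable A : tensor R l m n.

(* [urun s U H used]: starting from [s], some iterations of the u-loop, taking
   unused pairs in any order, have produced the list [U] of new vectors, the
   coefficients [H] and the list [used] of used pairs. *)
Inductive urun (s : kstate) : seq 'cV[R]_l -> (nat -> nat -> nat -> R) ->
    seq (nat * nat) -> Prop :=
| urun_nil : urun s [::] (coef s) (usedu s)
| urun_next U H used b c h u :
    urun s U H used ->
    (b < size (vs s))%N -> (c < size (ws s))%N -> (b, c) \notin used ->
    let v := (vs s)`_b in
    let w := (ws s)`_c in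
    let a := size (us s) in
    let hs := [seq tvec A x v w | x <- U] in
    normalizes h u (tvec23 A v w - colsmx (us s) *m (\col_i H i b c)
                                 - colsmx U *m (\col_i hs`_i)) ->
    urun s (rcons U u)
      (fun i j k => fill ((j, k) == (b, c)) a hs h i (H i j k))
      ((b, c) :: used).

Inductive vrun (s : kstate) : seq 'cV[R]_m -> (nat -> nat -> nat -> R) ->
    seq (nat * nat) -> Prop :=
| vrun_nil : vrun s [::] (coef s) (usedv s)
| vrun_next V H used a c h v :
    vrun s V H used ->
    (a < size (us s))%N -> (c < size (ws s))%N -> (a, c) \notin used ->
    let u := (us s)`_a in
    let w := (ws s)`_c in
    let b := size (vs s) in
    let hs := [seq tvec A u x w | x <- V] in
    normalizes h v (tvec13 A u w - colsmx (vs s) *m (\col_j H a j c)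
                                 - colsmx V *m (\col_j hs`_j)) ->
    vrun s (rcons V v)
      (fun i j k => fill ((i, k) == (a, c)) b hs h j (H i j k))
      ((a, c) :: used).

Inductive wrun (s : kstate) : seq 'cV[R]_n -> (nat -> nat -> nat -> R) ->
    seq (nat * nat) -> Prop :=
| wrun_nil : wrun s [::] (coef s) (usedw s)
| wrun_next W H used a b h w :
    wrun s W H used ->
    (a < size (us s))%N -> (b < size (vs s))%N -> (a, b) \notin used ->
    let u := (us s)`_a in
    let v := (vs s)`_b in
    let c := size (ws s) in
    let hs := [seq tvec A u v x | x <- W] in
    normalizes h w (tvec12 A u v - colsmx (ws s) *m (\col_k H a b k)
                                 - colsmx W *m (\col_k hs`_k)) ->
    wrun s (rcons W w)
      (fun i j k => fill ((i, j) == (a, b)) c hs h k (H i j k))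
      ((a, b) :: used).

Definition exhausted (p q : nat) (used : seq (nat * nat)) : Prop :=
  forall i j, (i < p)%N -> (j < q)%N -> (i, j) \in used.

Definition uloop (s s' : kstate) : Prop :=
  exists U H used,
    [/\ urun s U H used, exhausted (size (vs s)) (size (ws s)) used
      & s' = KState (us s ++ U) (vs s) (ws s) H used (usedv s) (usedw s)].

Definition vloop (s s' : kstate) : Prop :=
  exists V H used,
    [/\ vrun s V H used, exhausted (size (us s)) (size (ws s)) used
      & s' = KState (us s) (vs s ++ V) (ws s) H (usedu s) used (usedw s)].

Definition wloop (s s' : kstate) : Prop :=
  exists W H used,
    [/\ wrun s W H used, exhausted (size (us s)) (size (vs s)) used
      & s' = KState (us s) (vs s) (ws s ++ W) H (usedu s) (usedv s) used].

Definition kstart (u1 : 'cV[R]_l) (v1 : 'cV[R]_m) (s : kstate) : Prop :=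
  exists h w1,
    normalizes h w1 (tvec12 A u1 v1) /\
    s = KState [:: u1] [:: v1] [:: w1]
          (fun i j k => if [&& i == 0, j == 0 & k == 0]%N then h else 0)
          [::] [::] [:: (0, 0)%N].

(* The states reached by the recursion immediately before a u-loop. *)
Inductive krylov (u1 : 'cV[R]_l) (v1 : 'cV[R]_m) : kstate -> Prop :=
| krylov_start s : kstart u1 v1 s -> krylov u1 v1 s
| krylov_cycle s0 s1 s2 s3 :
    krylov u1 v1 s0 -> uloop s0 s1 -> vloop s1 s2 -> wloop s2 s3 ->
    krylov u1 v1 s3.

End Krylov.

(* Main.v *)
(** Each step of a loop merely solves the defining equation of the new vector
    for [A.(v,w)], so the fibre just stored expands [A.(v,w)] in the vectors of
    that mode; orthonormality plays no role.  Later loops change no stored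
    entry and later steps of the same loop only append zeros, so the expansion
    persists for every used pair.  A complete loop uses every pair exactly once,
    which gives the tensor identities and the number of vectors. *)

Require Import Defs.
From mathcomp Require Import all_boot all_order all_algebra.
From mathcomp Require Import reals.
From mathcomp Require Import zify.

Set Implicit Arguments.
Unset Strict Implicit.
Unset Printing Implicit Defensive.

Import Order.TTheory GRing.Theory Num.Theory.
Local Open Scope ring_scope.

(** Without repetitions, a list that lies in the rectangle and covers it is a permutation of the
    list of all its pairs. This turns the end of a loop into a count of vectors. *)
Lemma size_exhausted (p q : nat) (used : seq (nat * nat)) :
  uniq used -> (forall b c, (b, c) \in used -> (b < p)%N /\ (c < q)%N) ->
  exhausted p q used -> size used = (p * q)%N.
Proof.
move=> used_uniq used_lt used_all.
rewrite -[p in RHS](size_iota 0) -[q in RHS](size_iota 0) -(size_allpairs pair).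
apply/perm_size/uniq_perm => //.
  by apply: allpairs_uniq => [||[? ?] [? ?] _ _ [-> ->]] //; apply: iota_uniq.
move=> [b c]; apply/idP/allpairsP => [/used_lt [bp cq]|[[b' c'] /= []]].
  by exists (b, c); rewrite /= !mem_iota.
by rewrite !mem_iota => /= bp cq [-> ->]; apply: used_all.
Qed.

(** * One loop in an abstract mode *)

Section Mode.
Variables (R : realType) (p : nat).
Implicit Types (f : nat -> nat -> 'cV[R]_p) (X : seq 'cV[R]_p).
Implicit Types (G : nat -> nat -> nat -> R) (used : seq (nat * nat)).

Lemma colsmx_mul X (g : nat -> R) :
  colsmx X *m (\col_i g i) = \sum_(0 <= i < size X) g i *: X`_i.
Proof.
apply/colP => r; rewrite big_mkord mxE summxE.
by apply: eq_bigr => i _; rewrite !mxE mulrC.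
Qed.

(* The three loops differ only by the permutation of the arguments of the
   coefficient function: here [G b c] is the fibre of the pair [(b, c)], and
   [f b c] is the vector to be orthonormalized. *)
Inductive mode_run f (B C : nat) X0 G0 used0 :
    seq 'cV[R]_p -> (nat -> nat -> nat -> R) -> seq (nat * nat) -> Prop :=
| mode_run_nil : mode_run f B C X0 G0 used0 [::] G0 used0
| mode_run_next X G used b c hs h x :
    mode_run f B C X0 G0 used0 X G used ->
    (b < B)%N -> (c < C)%N -> (b, c) \notin used -> size hs = size X ->
    normalizes h x (f b c - colsmx X0 *m (\col_i G b c i)
                          - colsmx X *m (\col_i hs`_i)) ->
    mode_run f B C X0 G0 used0 (rcons X x)
      (fun j k i => fill ((j, k) == (b, c)) (size X0) hs h i (G j k i))
      ((b, c) :: used).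

(** The sum runs over all vectors of the mode, so it is a full fibre of the coefficient tensor.
    Uniqueness and the bounds serve only to count the pairs. *)
Definition mode_inv f (B C : nat) X G used : Prop :=
  uniq used /\
  forall b c, (b, c) \in used ->
    [/\ (b < B)%N, (c < C)%N & f b c = \sum_(0 <= i < size X) G b c i *: X`_i].

Lemma mode_run_size f B C X0 G0 used0 X G used :
  mode_run f B C X0 G0 used0 X G used -> size used = (size used0 + size X)%N.
Proof.
elim=> [|{}X {}G {}used b c hs h x _ IH *] /=; first by rewrite addn0.
by rewrite size_rcons addnS IH.
Qed.

(** [fill] writes only at positions from [size X0] on, be it coefficients or padding. *)
Lemma mode_run_old f B C X0 G0 used0 X G used b c i :
  mode_run f B C X0 G0 used0 X G used -> (i < size X0)%N -> G b c i = G0 b c i.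
Proof.
move=> run i_lt; elim: run => // {}X {}G {}used b' c' hs h x _ IH *.
rewrite /fill leqNgt i_lt /= ltn_eqF ?IH ?if_same //.
exact: leq_trans (leq_addr _ _).
Qed.

(** By induction on the steps: the new pair gets its expansion from the equation that defines [x],
    and every other used pair gets one more term, with coefficient zero. *)
Lemma mode_inv_run f B C X0 G0 used0 X G used :
  mode_inv f B C X0 G0 used0 -> mode_run f B C X0 G0 used0 X G used ->
  mode_inv f B C (X0 ++ X) G used.
Proof.
move=> inv0; elim=> [|{}X {}G {}used b c hs h x _ [used_uniq IH] bB cC].
  by rewrite cats0.
move=> bc_new size_hs [_ _ eq_x].
split=> [|j k]; first by rewrite /= bc_new.
rewrite inE /fill size_hs -rcons_cat size_rcons big_nat_recr //= => jk_used.
have -> : (rcons (X0 ++ X) x)`_(size (X0 ++ X)) = x.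
  by rewrite nth_rcons ltnn eqxx.
rewrite size_cat leqnn leq_addr addKn eqxx.
have eq_X i : (i < size X0 + size X)%N -> (rcons (X0 ++ X) x)`_i = (X0 ++ X)`_i.
  by rewrite nth_rcons size_cat => ->.
case: (altP (_ =P _)) jk_used => [[-> ->] _|_ /= /IH [jB kC ->]]; split=> //.
(* Current pair: the last term [h *: x] is replaced by [f b c] minus its components. The remaining
   sum is cut at [size X0] and its tail reindexed from 0, to be matched with the stored coefficients
   and with [hs]. *)
- rewrite nth_rcons size_hs ltnn eqxx eq_x !colsmx_mul -addrA -opprD.
  rewrite (@big_cat_nat _ _ _ (size X0)) ?leq_addr //=.
  rewrite -[in X in _ + X + _](add0n (size X0)) big_addn add0n addKn.
  rewrite addrC; apply: (canRL (subrK _)); congr (_ - _).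
  congr (_ + _); apply: eq_big_nat => i /andP [_ i_lt].
    rewrite eq_X; last exact: ltn_addr.
    by rewrite nth_cat i_lt leqNgt i_lt.
  rewrite eq_X; last by rewrite addnC ltn_add2l.
  rewrite leq_addl addnC leq_add2l ltnW //= addKn nth_rcons size_hs i_lt.
  by rewrite nth_cat ltnNge leq_addr /= addKn.
(* Any other pair: the padding zero kills the new term. *)
- rewrite scale0r addr0 size_cat; apply: eq_big_nat => i /andP [_ i_lt].
  by rewrite ltn_eqF ?eq_X.
Qed.

(** Meant for the two modes in which a loop generates nothing: its new vectors only enlarge the
    range of admissible pairs there, and the data of the old pairs stay the same. *)
Lemma mode_inv_extend f B C X G used f' B' C' G' :
  mode_inv f B C X G used -> (B <= B')%N -> (C <= C')%N ->
  (forall b c, (b < B)%N -> (c < C)%N -> f' b c = f b c) ->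
  (forall b c i, (b < B)%N -> (c < C)%N -> (i < size X)%N ->
    G' b c i = G b c i) ->
  mode_inv f' B' C' X G' used.
Proof.
move=> [used_uniq inv] BB' CC' eqf eqG; split=> // b c /inv [bB cC fE].
split; [exact: leq_trans bB BB'|exact: leq_trans cC CC'|].
by rewrite eqf // fE; apply: eq_big_nat => i /andP [_ i_lt]; rewrite eqG.
Qed.

Lemma mode_inv_exhausted f B C X G used :
  mode_inv f B C X G used -> exhausted B C used -> size used = (B * C)%N.
Proof.
case=> used_uniq inv; apply: size_exhausted => // b c.
by case/inv.
Qed.

End Mode.

(** * The invariant of all three modes and its preservation by the loops *)

Section State.
Variables (R : realType) (l m n : nat) (A : tensor R l m n).
Implicit Types s : kstate R l m n.

Definition uvec s b c := tvec23 A (vs s)`_b (ws s)`_c.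
Definition vvec s a c := tvec13 A (us s)`_a (ws s)`_c.
Definition wvec s a b := tvec12 A (us s)`_a (vs s)`_b.

Definition uinv s :=
  mode_inv (uvec s) (size (vs s)) (size (ws s)) (us s)
    (fun b c a => coef s a b c) (usedu s).
Definition vinv s :=
  mode_inv (vvec s) (size (us s)) (size (ws s)) (vs s)
    (fun a c b => coef s a b c) (usedv s).
Definition winv s :=
  mode_inv (wvec s) (size (us s)) (size (vs s)) (ws s)
    (fun a b c => coef s a b c) (usedw s).

(* The starting vectors [u1] and [v1] are generated from no pair, while [w1]
   uses up the pair of their indices. *)
Definition kinv s : Prop :=
  [/\ uinv s, vinv s & winv s] /\
  [/\ size (us s) = (size (usedu s)).+1, size (vs s) = (size (usedv s)).+1
    & size (ws s) = size (usedw s)].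

Lemma urun_mode_run s U H used :
  urun A s U H used ->
  mode_run (uvec s) (size (vs s)) (size (ws s)) (us s)
    (fun b c a => coef s a b c) (usedu s) U (fun b c a => H a b c) used.
Proof.
elim=> [|{}U {}H {}used b c h u _ run b_lt c_lt new v w a hs nrm].
  exact: mode_run_nil.
by apply: (mode_run_next run) => //; rewrite size_map.
Qed.

Lemma vrun_mode_run s V H used :
  vrun A s V H used ->
  mode_run (vvec s) (size (us s)) (size (ws s)) (vs s)
    (fun a c b => coef s a b c) (usedv s) V (fun a c b => H a b c) used.
Proof.
elim=> [|{}V {}H {}used a c h v _ run a_lt c_lt new u w b hs nrm].
  exact: mode_run_nil.
by apply: (mode_run_next run) => //; rewrite size_map.
Qed.

Lemma wrun_mode_run s W H used :
  wrun A s W H used ->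
  mode_run (wvec s) (size (us s)) (size (vs s)) (ws s)
    (coef s) (usedw s) W H used.
Proof.
elim=> [|{}W {}H {}used a b h w _ run a_lt b_lt new u v c hs nrm].
  exact: mode_run_nil.
by apply: (mode_run_next run) => //; rewrite size_map.
Qed.

(** The [u]-mode evolves by [mode_inv_run]. The other two are only extended, since appending to
    [us s] and writing at first indices beyond it leave their old pairs intact. *)
Lemma kinv_uloop s s' :
  kinv s -> uloop A s s' ->
  [/\ kinv s', exhausted (size (vs s')) (size (ws s')) (usedu s'),
      [/\ exists U, us s' = us s ++ U, vs s' = vs s & ws s' = ws s]
    & forall a b c, (a < size (us s))%N -> coef s' a b c = coef s a b c].
Proof.
move=> [[iu iv iw] [su sv sw]] [U [H [used [/urun_mode_run run ex ->]]]].
have old a b c : (a < size (us s))%N -> H a b c = coef s a b c.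
  exact: (mode_run_old b c run).
split=> //=; last by split=> //; exists U.
split; first split.
- exact: mode_inv_run iu run.
- apply: (mode_inv_extend iv) => //= [|a c a_lt _|a c b a_lt _ _].
  + by rewrite size_cat leq_addr.
  + by rewrite /vvec /= nth_cat a_lt.
  + exact: old.
- apply: (mode_inv_extend iw) => //= [|a b a_lt _|a b c a_lt _ _].
  + by rewrite size_cat leq_addr.
  + by rewrite /wvec /= nth_cat a_lt.
  + exact: old.
- by split=> //=; rewrite size_cat su (mode_run_size run).
Qed.

Lemma kinv_vloop s s' :
  kinv s -> vloop A s s' ->
  [/\ kinv s', exhausted (size (us s')) (size (ws s')) (usedv s'),
      [/\ us s' = us s, exists V, vs s' = vs s ++ V & ws s' = ws s]
    & forall a b c, (b < size (vs s))%N -> coef s' a b c = coef s a b c].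
Proof.
move=> [[iu iv iw] [su sv sw]] [V [H [used [/vrun_mode_run run ex ->]]]].
have old a b c : (b < size (vs s))%N -> H a b c = coef s a b c.
  exact: (mode_run_old a c run).
split=> //=; last by split=> //; exists V.
split; first split.
- apply: (mode_inv_extend iu) => //= [|b c b_lt _|b c a b_lt _ _].
  + by rewrite size_cat leq_addr.
  + by rewrite /uvec /= nth_cat b_lt.
  + exact: old.
- exact: mode_inv_run iv run.
- apply: (mode_inv_extend iw) => //= [|a b _ b_lt|a b c _ b_lt _].
  + by rewrite size_cat leq_addr.
  + by rewrite /wvec /= nth_cat b_lt.
  + exact: old.
- by split=> //=; rewrite size_cat sv (mode_run_size run).
Qed.

Lemma kinv_wloop s s' :
  kinv s -> wloop A s s' ->
  [/\ kinv s', exhausted (size (us s')) (size (vs s')) (usedw s'),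
      [/\ us s' = us s, vs s' = vs s & exists W, ws s' = ws s ++ W]
    & forall a b c, (c < size (ws s))%N -> coef s' a b c = coef s a b c].
Proof.
move=> [[iu iv iw] [su sv sw]] [W [H [used [/wrun_mode_run run ex ->]]]].
have old a b c : (c < size (ws s))%N -> H a b c = coef s a b c.
  exact: (mode_run_old a b run).
split=> //=; last by split=> //; exists W.
split; first split.
- apply: (mode_inv_extend iu) => //= [|b c _ c_lt|b c a _ c_lt _].
  + by rewrite size_cat leq_addr.
  + by rewrite /uvec /= nth_cat c_lt.
  + exact: old.
- apply: (mode_inv_extend iv) => //= [|a c _ c_lt|a c b _ c_lt _].
  + by rewrite size_cat leq_addr.
  + by rewrite /vvec /= nth_cat c_lt.
  + exact: old.
- exact: mode_inv_run iw run.
- by split=> //=; rewrite size_cat sw (mode_run_size run).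
Qed.

Lemma size_vs_vloop s s' : kinv s -> vloop A s s' ->
  size (vs s') = (size (us s) * size (ws s)).+1.
Proof.
move=> inv /(kinv_vloop inv) [[[_ iv _] [_ sv _]] ex [<- _ <-] _].
by rewrite sv (mode_inv_exhausted iv ex).
Qed.

Lemma size_ws_wloop s s' : kinv s -> wloop A s s' ->
  size (ws s') = (size (us s) * size (vs s))%N.
Proof.
move=> inv /(kinv_wloop inv) [[[_ _ iw] [_ _ sw]] ex [<- <- _] _].
by rewrite sw (mode_inv_exhausted iw ex).
Qed.

(** The inequality is what later makes the [v]-loop strictly increase the number of [v]-vectors. It
    holds after a cycle because the [w]-loop ends with $\gamma=\alpha\beta$, so
    $\alpha\gamma=\alpha^2\beta\ge\beta$. *)
Lemma krylov_kinv u1 v1 s : krylov A u1 v1 s ->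
  kinv s /\ (size (vs s) <= size (us s) * size (ws s))%N.
Proof.
elim=> [{}s [h [w1 [[_ _ eq_w1] ->]]]|s0 s1 s2 s3 _ [inv0 _] lu lv lw].
  (* At the start only the [w]-mode has a used pair, [(0, 0)], and its expansion is the equation
     that defines [w1]. *)
  split=> //; split=> //; split; split=> // a b; rewrite inE => /eqP [-> ->].
  by split=> //=; rewrite big_nat1.
have [inv1 _ _ _] := kinv_uloop inv0 lu.
have [inv2 _ [us2 _ _] _] := kinv_vloop inv1 lv.
have [inv3 _ [us3 vs3 _] _] := kinv_wloop inv2 lw.
(* [us_gt0] equates [size (us s2)] with a successor; rewriting with it makes positivity evident. *)
split=> //; have [_ [us_gt0 _ _]] := inv2.
by rewrite us3 vs3 (size_ws_wloop inv2 lw) us_gt0 mulnA leq_pmull.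
Qed.

(** * Tensor identities and nested coefficient tensors *)

Lemma tmul23_mode1 s : uinv s ->
  exhausted (size (vs s)) (size (ws s)) (usedu s) ->
  tmul23 A (colsmx (vs s)) (colsmx (ws s)) = mode1 (colsmx (us s)) (Hten s).
Proof.
move=> [_ inv] ex; apply/ffunP => -[[i j] k].
have [_ _ /colP/(_ i)] := inv j k (ex j k (ltn_ord j) (ltn_ord k)).
rewrite !(ffunE, mxE) /= summxE big_mkord => eq_jk.
under eq_bigr do under eq_bigr do rewrite !mxE.
by rewrite eq_jk; apply: eq_bigr => a _; rewrite ffunE !mxE mulrC.
Qed.

Lemma tmul13_mode2 s : vinv s ->
  exhausted (size (us s)) (size (ws s)) (usedv s) ->
  tmul13 A (colsmx (us s)) (colsmx (ws s)) = mode2 (colsmx (vs s)) (Hten s).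
Proof.
move=> [_ inv] ex; apply/ffunP => -[[i j] k].
have [_ _ /colP/(_ j)] := inv i k (ex i k (ltn_ord i) (ltn_ord k)).
rewrite !(ffunE, mxE) /= summxE big_mkord => eq_ik.
under eq_bigr do under eq_bigr do rewrite !mxE.
by rewrite eq_ik; apply: eq_bigr => b _; rewrite ffunE !mxE mulrC.
Qed.

Lemma tmul12_mode3 s : winv s ->
  exhausted (size (us s)) (size (vs s)) (usedw s) ->
  tmul12 A (colsmx (us s)) (colsmx (vs s)) = mode3 (colsmx (ws s)) (Hten s).
Proof.
move=> [_ inv] ex; apply/ffunP => -[[i j] k].
have [_ _ /colP/(_ k)] := inv i j (ex i j (ltn_ord i) (ltn_ord j)).
rewrite !(ffunE, mxE) /= summxE big_mkord => eq_ij.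
under eq_bigr do under eq_bigr do rewrite !mxE.
by rewrite eq_ij; apply: eq_bigr => c _; rewrite ffunE !mxE mulrC.
Qed.

(** Agreement is asked under bounds on both [b] and [c], so that the same statement serves the
    [v]-loop, which preserves entries with old [b], and the [w]-loop, which preserves those with old
    [c]. *)
Lemma leading_block_Hten s s' :
  (size (us s) <= size (us s'))%N -> (size (vs s) <= size (vs s'))%N ->
  (size (ws s) <= size (ws s'))%N ->
  (forall a b c, (b < size (vs s))%N -> (c < size (ws s))%N ->
    coef s' a b c = coef s a b c) ->
  leading_block (Hten s) (Hten s').
Proof.
move=> us_le vs_le ws_le old; split=> // i j k i' j' k' ei ej ek.
by rewrite !ffunE /= ei ej ek old.
Qed.

End State.

Theorem theorem5 (R : realType) (l m n : nat) (A : tensor R l m n)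
    (u1 : 'cV[R]_l) (v1 : 'cV[R]_m) (s0 s1 : kstate R l m n)
    (hu1 : length2 u1 = 1) (hv1 : length2 v1 = 1)
    (hs0 : krylov A u1 v1 s0)
    (hs1 : uloop A s0 s1)
    (hon1 : orthonormal_state s1)
    (hal : (size (us s1) <= l)%N) (hbe : (size (vs s1) <= m)%N)
    (hga : (size (ws s1) <= n)%N) :
  tmul23 A (colsmx (vs s1)) (colsmx (ws s1)) = mode1 (colsmx (us s1)) (Hten s1)
  /\
  (forall s2 : kstate R l m n, vloop A s1 s2 -> orthonormal_state s2 ->
    [/\ size (vs s2) = (size (us s1) * size (ws s1) + 1)%N,
        (size (vs s1) < size (vs s2))%N,
        tmul13 A (colsmx (us s2)) (colsmx (ws s2))
          = mode2 (colsmx (vs s2)) (Hten s2),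
        leading_block (Hten s1) (Hten s2)
      & forall s3 : kstate R l m n, wloop A s2 s3 -> orthonormal_state s3 ->
        [/\ size (ws s3) = (size (us s2) * size (vs s2))%N,
            (size (ws s2) < size (ws s3))%N,
            tmul12 A (colsmx (us s3)) (colsmx (vs s3))
              = mode3 (colsmx (ws s3)) (Hten s3)
          & leading_block (Hten s2) (Hten s3)]]).
Proof.
have [inv0 vs_le0] := krylov_kinv hs0.
have [inv1 exu [[U us1] vs1 ws1] _] := kinv_uloop inv0 hs1.
have [[iu _ _] [us_gt0 _ _]] := inv1.
split=> [|s2 hs2 _]; first exact: tmul23_mode1.
have [inv2 exv [us2 _ ws2] old2] := kinv_vloop inv1 hs2.
have [[_ iv _] _] := inv2.
have size_vs2 := size_vs_vloop inv1 hs2.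
(* The bound $\beta\le\alpha\gamma$ known before the [u]-loop survives it, as only $\alpha$ grows;
   hence $\beta<\alpha\gamma+1$. *)
have vs_lt : (size (vs s1) < size (vs s2))%N.
  rewrite size_vs2 ltnS vs1 (leq_trans vs_le0) // us1 ws1 size_cat.
  by rewrite leq_mul2r leq_addr orbT.
split=> //; [by rewrite addn1|exact: tmul13_mode2| |].
  by apply: leading_block_Hten => *; rewrite ?us2 ?ws2 ?(ltnW vs_lt) ?old2.
move=> s3 hs3 _.
have [inv3 exw [us3 vs3 _] old3] := kinv_wloop inv2 hs3.
have [[_ _ iw] _] := inv3.
have size_ws3 := size_ws_wloop inv2 hs3.
(* Here $\bar\gamma=\alpha(\alpha\gamma+1)=\alpha+\alpha^2\gamma$, which exceeds $\gamma$ because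
   $\alpha\ge 1$. *)
have ws_lt : (size (ws s2) < size (ws s3))%N.
  by rewrite size_ws3 size_vs2 us2 ws2 us_gt0 mulnS; nia.
split=> //; first exact: tmul12_mode3.
by apply: leading_block_Hten => *; rewrite ?us3 ?vs3 ?(ltnW ws_lt) ?old3.
Qed.
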